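(* Let $w\ge0$ and $m\ge 0$ be integers, let $T\subset\mathbb{N}=\{1,2,\dots\}$ be finite, let $f$ be a monic polynomial over $\mathbb{F}_q$, and let $l_i\ge0$ be integers for $i\in T$. Suppose that $\sum_{i\in T}i(|I_i|+l_i)\le m-w$. Let $N^*(m,\prod_{i\in T}I_i^{l_i},\langle f\rangle)$ be the number of monic polynomials $g$ over $\mathbb{F}_q$ of degree $m$ with $\langle g\rangle=\langle f\rangle$ such that, for each $i\in T$, $g$ has exactly $l_i$ monic irreducible factors of degree $i$ counted with multiplicity. Then $$N^*\Big(m,\prod_{i\in T}I_i^{l_i},\langle f\rangle\Big)=q^{m-w}\prod_{i\in T}\binom{|I_i|+l_i-1}{l_i}\left(\frac1{q^{i}}\right)^{l_i}\left(1-\frac1{q^{i}}\right)^{|I_i|}.$$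
   Context: $\mathbb{F}_q$ is a finite field with $q=p^e$ elements, $p$ prime, $e\ge1$. $I_i$ is the set of monic irreducible polynomials of degree $i$ over $\mathbb{F}_q$. For a monic polynomial $f$ of degree $d(f)$ write $f=x^{d(f)}+f_1x^{d(f)-1}+\cdots+f_{d(f)}$ and set $f_j=0$ for $j>d(f)$. For the fixed integer $w\ge0$, $\langle f\rangle$ denotes $x^{d(f)}f(1/x)\bmod x^{w+1}$, i.e. the class of $1+f_1x+\cdots+f_wx^w$ modulo $x^{w+1}$. The number of monic irreducible factors of $g$ of degree $i$ counted with multiplicity is $\sum_{h\in I_i}\max\{k:h^k\mid g\}$. *)

(* Defs.v *)
From mathcomp Require Import all_boot all_order all_algebra.
From mathcomp Require Import qpoly.
From mathcomp Require Import finmap.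

Set Implicit Arguments.
Unset Strict Implicit.
Unset Printing Implicit Defensive.

Import GRing.Theory.
Local Open Scope ring_scope.

(* x ^ d(f) * f (1 / x), for f != 0 of degree d(f) = (size f).-1 *)
Definition recip_poly (F : fieldType) (f : {poly F}) : {poly F} :=
  \poly_(j < size f) f`_((size f).-1 - j).

(* The class <f> in F[x] / (x ^ (w + 1)).  As 'X^(w.+1) is monic of size w + 2,
   {poly %/ 'X^(w.+1)} is that quotient also when w = 0. *)
Definition angle (F : fieldType) (w : nat) (f : {poly F}) :
    {poly %/ ('X^(w.+1) : {poly F})} :=
  in_qpoly 'X^(w.+1) (recip_poly f).

Definition monic_of_deg (F : fieldType) (n : nat) : pred {poly F} :=
  fun f => (f \is monic) && (size f == n.+1).

(* A polynomial of degree i is an element of {poly_(i.+1) F}, a finite type. *)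
Definition Irr (F : finFieldType) (i : nat) : {set {poly_(i.+1) F}} :=
  [set h : {poly_(i.+1) F} |
    monic_of_deg i (polyn h) && irreducibleb (polyn h)].

(* max {k : h ^ k %| g}; for g != 0 and h nonconstant, h ^ k %| g forces
   k <= deg g < size g, so that the bound on k loses nothing. *)
Definition mult (F : fieldType) (h g : {poly F}) : nat :=
  (\max_(k < size g | (h ^+ k %| g)%R) k)%N.

Definition num_irr_factors (F : finFieldType) (i : nat) (g : {poly F}) : nat :=
  (\sum_(h in Irr F i) mult (polyn h) g)%N.

Definition Nstar (F : finFieldType) (w m : nat) (T : {fset nat}) (l : nat -> nat)
    (f : {poly F}) : nat :=
  #|[set g : {poly_(m.+1) F} |
      [&& monic_of_deg m (polyn g),
          angle w (polyn g) == angle w f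
        & all (fun i => num_irr_factors i (polyn g) == l i) (enum_fset T)]]|.

(* Main.v *)
(* Call a condition Q on monic polynomials equidistributed, with density C and
   cost b, if for every monic u and n >= w + b exactly C q^(n-w) monic g of
   degree n satisfy both Q and <ug> = <f>.  The trivial condition has density 1
   and cost 0: <ug> = <f> fixes the top w + 1 coefficients of ug, hence by
   division fixes g up to a polynomial of degree < n - w.  If Q is insensitive to
   factors h, with h irreducible of degree d, then writing g = h^k g' and absorbing
   h^k into u shows that adding the condition h^k | g multiplies the density by
   q^(-dk); subtracting the counts for k = j and k = j + 1, adding the condition
   "h has multiplicity exactly j in g" multiplies it by q^(-dj) (1 - q^(-d)) and
   costs d (j + 1).  Adjoining the irreducible polynomials one at a time and
   summing over their multiplicities produces the binomial coefficients. *)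

Require Import Defs.
From mathcomp Require Import all_boot all_order all_algebra.
From mathcomp Require Import qpoly finmap zify ring.

Set Implicit Arguments.
Unset Strict Implicit.
Unset Printing Implicit Defensive.

Import GRing.Theory Num.Theory.
Local Open Scope ring_scope.

(** * The class [angle] in terms of coefficients *)

Lemma in_qpoly_Xn_eqP (R : nzRingType) (w : nat) (a b : {poly R}) :
  reflect (forall j, (j <= w)%N -> a`_j = b`_j)
          (in_qpoly 'X^(w.+1) a == in_qpoly 'X^(w.+1) b).
Proof.
(* [mk_monic] keeps the modulus, as it is monic and nonconstant; the representative is then the
   truncation to the lowest [w.+1] coefficients. *)
rewrite -val_eqE /= /mk_monic size_polyXn /= monicXn -!Pdiv.RingMonic.take_poly_rmodp.
apply: (iffP eqP) => [eq_ab j le_jw | eq_ab]; last first.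
  by apply/polyP=> j; rewrite !coef_take_poly ltnS; case: leqP => // /eq_ab.
by have /polyP/(_ j) := eq_ab; rewrite !coef_take_poly ltnS le_jw.
Qed.

Section AngleMult.
Variable F : fieldType.
Implicit Types a f g h : {poly F}.

Lemma coef_recip_poly f j : f != 0 ->
  (recip_poly f)`_j = if (j <= (size f).-1)%N then f`_((size f).-1 - j) else 0.
Proof. by move=> f0; rewrite coef_poly -[in RHS]ltnS prednK ?size_poly_gt0. Qed.

(* Clears denominators in <a> = <f>, whose two sides are indexed from the top. *)
Lemma angle_eqE (w : nat) a f : a != 0 -> f != 0 -> (w <= (size a).-1)%N ->
  (angle w a == angle w f) =
  (size (a * 'X^((size f).-1) - f * 'X^((size a).-1))%R <=
    (size a).-1 + (size f).-1 - w)%N.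
Proof.
move=> a0 f0 le_wa; set da := (size a).-1; set df := (size f).-1.
have sa : size a = da.+1 by rewrite prednK ?size_poly_gt0.
have sf : size f = df.+1 by rewrite prednK ?size_poly_gt0.
(* The two powers of the variable align the leading terms; for [j > df] the contribution of [f] is 0
   on both sides. *)
have top j : (j <= da)%N ->
    (a * 'X^df - f * 'X^da)`_(da + df - j) = (recip_poly a)`_j - (recip_poly f)`_j.
  move=> le_j; rewrite coefB !coefMXn !coef_recip_poly // -/da -/df le_j.
  have -> : (da + df - j < df)%N = false by lia.
  congr (_`_ _ - _); first lia.
  case: (leqP j df) => hj.
    have -> : (da + df - j < da)%N = false by lia.
    by congr (_`_ _); lia.
  by have -> : (da + df - j < da)%N by lia.
apply/in_qpoly_Xn_eqP/idP => [eq_af | /leq_sizeP big0 j le_jw]; last first.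
  by apply/eqP; rewrite -subr_eq0 -top ?big0 //; lia.
apply/leq_sizeP => j le_j.
have [lt_j | le_jd] := ltnP (da + df) j.
  rewrite nth_default //; apply: leq_trans lt_j.
  rewrite (leq_trans (size_polyD _ _)) // size_polyN geq_max !size_mulXn // sa sf.
  by rewrite !addnS (addnC df) leqnn.
by rewrite -(subKn le_jd) top ?eq_af ?subrr //; lia.
Qed.

(** * Multiplicities of irreducible factors *)

Lemma dvdp_exp_leq_mult h g k : (1 < size h)%N -> g != 0 ->
  (k <= mult h g)%N = (h ^+ k %| g).
Proof.
move=> h_gt1 g0.
have h0 : h != 0 by rewrite -size_poly_gt0 ltnW.
apply/idP/idP => [le_k | dvd_k].
  have sg : (0 < size g)%N by rewrite size_poly_gt0.
  (* The maximum is attained, because the exponent 0 qualifies. *)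
  have [|i dvd_i eq_i] := @eq_bigmax_cond 'I_(size g) (fun k => h ^+ k %| g) (@nat_of_ord _).
    by apply/card_gt0P; exists (Ordinal sg); rewrite unfold_in /= expr0 dvd1p.
  by apply: dvdp_trans dvd_i; rewrite dvdp_exp2l // -eq_i.
(* As [h] is nonconstant, [k] is at most the degree of [h ^+ k], hence within the range of the
   maximum. *)
have lt_k : (k < size g)%N.
  apply: leq_trans (dvdp_leq g0 dvd_k).
  rewrite -(@prednK (size (h ^+ k))) ?size_poly_gt0 ?expf_neq0 // ltnS size_exp.
  by rewrite leq_pmull // -subn1 subn_gt0.
exact: (@bigmax_sup _ (Ordinal lt_k) (fun k => h ^+ k %| g) _ (@nat_of_ord _)).
Qed.

(** By Gauss, [h'] affects no divisibility by a power of [h], and these divisibilities determine the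
    multiplicity. *)
Lemma mult_mul_coprime h h' g : (1 < size h)%N -> h' != 0 -> coprimep h h' -> g != 0 ->
  mult h (h' * g) = mult h g.
Proof.
move=> h_gt1 h'0 co_hh' g0.
have eq_le k : (k <= mult h (h' * g))%N = (k <= mult h g)%N.
  by rewrite !dvdp_exp_leq_mult ?mulf_neq0 // Gauss_dvdpr ?coprimep_expl.
by apply/eqP; rewrite eqn_leq -eq_le leqnn eq_le leqnn.
Qed.

(** A nonconstant gcd would be associated to both polynomials, and associated monic polynomials are
    equal. *)
Lemma monic_irreducible_coprimep h h' : h \is monic -> h' \is monic ->
  irreducible_poly h -> irreducible_poly h' -> h != h' -> coprimep h h'.
Proof.
move=> mh mh' [_ dvd_h] [_ dvd_h']; apply: contraNT => ncop; rewrite -eqp_monic //.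
apply: eqp_trans (dvd_h' _ ncop (dvdp_gcdr _ _)).
by rewrite eqp_sym; exact: dvd_h ncop (dvdp_gcdl _ _).
Qed.

End AngleMult.

(** * Counting monic polynomials of a fixed degree *)

Section Counting.
Variable F : finFieldType.
Implicit Types (f g h q u : {poly F}) (P Q : pred {poly F}).

Definition count_monic n P : nat :=
  #|[set g : {poly_(n.+1) F} | monic_of_deg n (polyn g) && P (polyn g)]|.

Lemma eq_count_monic n P Q :
  (forall g, g \is monic -> size g = n.+1 -> P g = Q g) ->
  count_monic n P = count_monic n Q.
Proof.
move=> eqPQ; apply: eq_card => g; rewrite !inE.
by apply: andb_id2l => /andP[mg /eqP sg]; apply: eqPQ.
Qed.

Lemma count_monicID n P Q :
  count_monic n P = (count_monic n (predI P Q) + count_monic n (predD P Q))%N.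
Proof.
rewrite /count_monic -(cardsID [set g : {poly_(n.+1) F} | Q (polyn g)]).
congr (_ + _)%N; apply: eq_card => g; rewrite !inE /= ?andbA //.
by rewrite /monic_of_deg; case: (Q g); rewrite /= ?andbF ?andbT.
Qed.

(** Multiplication by [h] maps the monic polynomials of degree [n] bijectively onto the monic
    multiples of [h] of degree [d + n]. *)
Lemma count_monic_dvd d n h P : monic_of_deg d h ->
  count_monic (d + n) (fun g => (h %| g) && P g) = count_monic n (fun g => P (h * g)).
Proof.
case/andP=> mh /eqP sh.
have h0 := monic_neq0 mh.
have szM g : g != 0 -> size (h * g) = (d + size g)%N.
  by move=> g0; rewrite size_monicM // sh.
pose mulh (g : {poly_(n.+1) F}) : {poly_((d + n).+1) F} := npolyp _ (h * g).
have mulhE (g : {poly_(n.+1) F}) : polyn (mulh g) = h * polyn g.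
  rewrite npolypK //; have [-> | g0] := eqVneq (polyn g) 0; first by rewrite mulr0 size_poly0.
  by rewrite szM // -addnS leq_add2l size_npoly.
rewrite /count_monic -(card_imset _ (_ : injective mulh)); last first.
  by move=> a b /(congr1 (@polyn _ _)); rewrite !mulhE => /(mulfI h0) /val_inj.
apply: eq_card => g; rewrite !inE; apply/andP/imsetP => [[]|[a]].
  case/andP=> mg /eqP sg /andP[/dvdpP[b def_g] Pg].
  have b0 : b != 0.
    by apply: contraTneq mg => b0; rewrite def_g b0 mul0r monicE lead_coef0 eq_sym oner_eq0.
  have sb : size b = n.+1 by move: sg; rewrite def_g mulrC szM // -addnS => /addnI.
  have mb : b \is monic by rewrite -(monicMl _ mh) mulrC -def_g.
  have bK : polyn (npolyp n.+1 b) = b by rewrite npolypK ?sb.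
  exists (npolyp n.+1 b); last by apply: val_inj; rewrite /= mulhE bK def_g mulrC.
  by rewrite !inE bK /monic_of_deg mb sb eqxx mulrC -def_g.
rewrite inE => /andP[/andP[ma /eqP sa] Pa] ->.
rewrite mulhE /monic_of_deg monicMl // ma szM ?monic_neq0 // sa addnS eqxx.
by rewrite dvdp_mulr.
Qed.

Lemma count_monic_sum n P (A B : {poly F} -> nat) (l : nat) :
  count_monic n (fun g => P g && (A g + B g == l)%N) =
  (\sum_(j < l.+1) count_monic n (fun g => P g && (B g == l - j)%N && (A g == j)))%N.
Proof.
(* [inord] sends values above [l] to a default; none occur, since [A g + B g = l]. *)
pose cls (g : {poly_(n.+1) F}) : 'I_l.+1 := inord (A (polyn g)).
rewrite /count_monic -sum1_card (partition_big cls predT) //=.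
apply: eq_bigr => j _; rewrite sum1_card; apply: eq_card => g.
rewrite unfold_in /= !inE /monic_of_deg -!andbA; do 3!congr (_ && _).
have lt_j := ltn_ord j.
apply/andP/andP=> [[/eqP eq_l /eqP/(congr1 val) /=] | [/eqP eqB /eqP eqA]].
  rewrite /cls inordK; last by rewrite ltnS -eq_l leq_addr.
  move=> eqA; rewrite -eqA; split; last by [].
  by rewrite -eq_l addKn eqxx.
by split; [rewrite eqA eqB subnKC | rewrite -val_eqE /= inordK eqA].
Qed.

Lemma count_monic_near n k q : monic_of_deg n q -> (k <= n)%N ->
  count_monic n (fun g => (size (g - q)%R <= k)%N) = (#|F| ^ k)%N.
Proof.
case/andP=> mq /eqP sq le_kn.
have lt_sq (s : {poly_k F}) : (size (polyn s) < size q)%N.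
  by rewrite sq ltnS (leq_trans (size_npoly s)).
pose shift (s : {poly_k F}) : {poly_(n.+1) F} := npolyp _ (q + s).
have shiftE (s : {poly_k F}) : polyn (shift s) = q + polyn s.
  by rewrite npolypK // size_polyDl ?sq // -sq.
rewrite -card_npoly /count_monic -(card_imset _ (_ : injective shift)); last first.
  by move=> a b /(congr1 (@polyn _ _)); rewrite !shiftE => /addrI /val_inj.
apply: eq_card => g; rewrite inE; apply/andP/imsetP => [[_ le_k]|[s _ ->]].
  exists (npolyp k (polyn g - q)) => //; apply: val_inj.
  by rewrite /= shiftE npolypK // addrC subrK.
rewrite shiftE addrAC subrr add0r size_npoly /monic_of_deg monicE lead_coefDl //.
by rewrite -monicE mq size_polyDl // sq eqxx.
Qed.

(** With denominators cleared, the condition says that [D * g] is close to [a]. Dividing [a] by [D]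
    gives a monic quotient [q] of degree [n], and the condition becomes closeness of [g] to [q]. *)
Lemma count_monic_angle w n u f : u \is monic -> f \is monic -> (w <= n)%N ->
  count_monic n (fun g => angle w (u * g) == angle w f) = (#|F| ^ (n - w))%N.
Proof.
move=> mu mf le_wn; pose du := (size u).-1; pose df := (size f).-1.
have su : size u = du.+1 by rewrite prednK ?size_poly_gt0 ?monic_neq0.
have sf : size f = df.+1 by rewrite prednK ?size_poly_gt0 ?monic_neq0.
pose D := u * 'X^df; pose a := f * 'X^(n + du).
have mD : D \is monic by rewrite monicMl ?monicXn.
have D0 := monic_neq0 mD.
have sD : size D = (du + df).+1.
  by rewrite size_mulXn ?monic_neq0 // su addnS addnC.
have ma : a \is monic by rewrite monicMl ?monicXn.
have sa : size a = (n + du + df).+1 by rewrite size_mulXn ?monic_neq0 // sf addnS.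
have def_a := divp_eq a D; set q := a %/ D in def_a; set r := a %% D in def_a.
have sr : (size r <= du + df)%N by rewrite -ltnS -sD ltn_modp.
have sq : size q = n.+1 by rewrite size_divp // sa sD /=; lia.
have q0 : q != 0 by rewrite -size_poly_gt0 sq.
have mq : q \is monic.
  rewrite -(monicMr _ mD) monicE -(lead_coefDl (q := r)) -?def_a -?monicE //.
  by rewrite size_Mmonic // sq sD; lia.
rewrite -(@count_monic_near n (n - w) q) ?leq_subr //; last by rewrite /monic_of_deg mq sq /=.
apply: eq_count_monic => g mg sg.
have sug : size (u * g) = (n + du).+1 by rewrite size_monicM ?monic_neq0 // su sg /=; lia.
rewrite angle_eqE ?mulf_neq0 ?monic_neq0 // ?sug /=; last first.
  by rewrite (leq_trans le_wn) ?leq_addr.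
have -> : u * g * 'X^((size f).-1) - f * 'X^(n + du) = D * (g - q) - r.
  by rewrite -/a def_a /D -/df mulrBr opprD addrA mulrAC (mulrC q).
have le_r : (size r <= n + du + df - w)%N by lia.
have -> : (size (D * (g - q) - r)%R <= n + du + (size f).-1 - w)%N =
          (size (D * (g - q))%R <= n + du + df - w)%N.
  apply/idP/idP => le_s; last first.
    by rewrite (leq_trans (size_polyD _ _)) // size_polyN geq_max le_s.
  by rewrite -(subrK r (D * _)) (leq_trans (size_polyD _ _)) // geq_max le_s.
have [-> | s0] := eqVneq (g - q) 0; first by rewrite mulr0 size_poly0.
rewrite size_monicM // sD addSn /=; move: (size _) => k.
by clearbody du df; clear -le_wn; lia.
Qed.

(** * Equidistributed conditions *)

Definition equidistributed (w : nat) f Q (C : rat) (b : nat) :=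
  forall n u, u \is monic -> (w + b <= n)%N ->
  (count_monic n (fun g => (angle w (u * g) == angle w f) && Q g))%:R =
    C * #|F|%:R ^+ (n - w).

Lemma eq_equidistributed w f Q Q' C b : (forall g, g \is monic -> Q g = Q' g) ->
  equidistributed w f Q C b -> equidistributed w f Q' C b.
Proof.
move=> eqQ eqd n u mu le_n; rewrite -(eqd n u) //; congr _%:R.
by apply: eq_count_monic => g mg _; rewrite eqQ.
Qed.

Lemma equidistributedT w f : f \is monic -> equidistributed w f predT 1 0.
Proof.
move=> f_monic n u mu; rewrite addn0 => le_wn; rewrite mul1r -natrX; congr _%:R.
rewrite -(count_monic_angle mu f_monic le_wn).
by apply: eq_count_monic => g _ _; rewrite andbT.
Qed.

Lemma equidistributed_mult w f Q C b d h (j : nat) :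
  equidistributed w f Q C b -> monic_of_deg d h -> irreducible_poly h ->
  (forall g, g \is monic -> Q (h * g) = Q g) ->
  equidistributed w f (fun g => Q g && (mult h g == j))
    (C * (1 / #|F|%:R ^+ d) ^+ j * (1 - 1 / #|F|%:R ^+ d)) (b + d * j.+1).
Proof.
move=> eqd /andP[mh /eqP sh] [h_gt1 _] invQ n u mu le_n.
set x : rat := 1 / _; pose A g := (angle w (u * g) == angle w f) && Q g.
have q0 : #|F|%:R != 0 :> rat.
  by rewrite pnatr_eq0 -lt0n; apply/card_gt0P; exists 0.
have invQX k g : g \is monic -> Q (h ^+ k * g) = Q g.
  elim: k => [|k IHk] mg; first by rewrite expr0 mul1r.
  by rewrite exprS -mulrA invQ ?IHk // monicMl // monic_exp.
(* Cancelling [h ^+ k] leaves degree [n - d * k], which is at least [w + b] up to [k = j.+1]; this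
   is where the cost comes from. *)
have count_dvd k : (k <= j.+1)%N ->
    (count_monic n (fun g => (h ^+ k %| g) && A g))%:R = C * x ^+ k * #|F|%:R ^+ (n - w).
  move=> le_k; have le_dk : (d * k <= d * j.+1)%N by rewrite leq_mul2l le_k orbT.
  have mhk : monic_of_deg (d * k) (h ^+ k).
    rewrite /monic_of_deg monic_exp // -(@prednK (size (h ^+ k))).
      by rewrite size_exp sh /= eqxx.
    by rewrite size_poly_gt0 monic_neq0 ?monic_exp.
  rewrite -[in LHS](@subnKC (d * k) n); last lia.
  rewrite count_monic_dvd //.
  rewrite (@eq_count_monic _ _
    (fun g => (angle w (u * h ^+ k * g) == angle w f) && Q g)); last first.
    by move=> g mg _; rewrite /A mulrA invQX.
  rewrite eqd ?monicMl ?monic_exp //; last lia.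
  rewrite -mulrA; congr (_ * _).
  have -> : (n - w = d * k + (n - d * k - w))%N by lia.
  by rewrite exprD mulrA /x exprM div1r exprVn mulVf ?mul1r // !expf_neq0.
rewrite (@eq_count_monic _ _
  (predD (fun g => (h ^+ j %| g) && A g) (fun g => h ^+ j.+1 %| g))); last first.
  move=> g mg _; rewrite /= -!dvdp_exp_leq_mult ?monic_neq0 //.
  by rewrite andbA [LHS]andbC eqn_leq -leqNgt -[LHS]andbA.
have := count_monicID n (fun g => (h ^+ j %| g) && A g) (fun g => h ^+ j.+1 %| g).
move/(congr1 (fun k => k%:R : rat)); rewrite natrD count_dvd //.
rewrite (@eq_count_monic _ (predI _ _) (fun g => (h ^+ j.+1 %| g) && A g)); last first.
  move=> g _ _ /=; rewrite andbC; case: (boolP (h ^+ j.+1 %| g)) => //= dvd_g.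
  by rewrite (dvdp_trans _ dvd_g) // dvdp_exp2l.
rewrite count_dvd // => /(canLR (addKr _)) <-.
by rewrite exprSr; ring.
Qed.

(** Multisets of size [l] from [k + 1] objects, sorted by the multiplicity [j] of one of them. The
    truncated subtraction matters only for [k = 0], [j = l], where the term is still 1. *)
Lemma sum_bin_diag k l : (\sum_(j < l.+1) 'C(k + (l - j) - 1, l - j))%N = 'C(k + l, l).
Proof.
elim: l => [|l IHl]; first by rewrite big_ord1 !bin0.
by rewrite big_ord_recl subn0 addnS subn1 /= binS addnC -IHl addnC.
Qed.

Lemma equidistributed_sum_mult w f Q C b d (l : nat) hs :
  equidistributed w f Q C b -> uniq hs ->
  (forall h, h \in hs -> monic_of_deg d h /\ irreducible_poly h) ->
  (forall h g, h \in hs -> g \is monic -> Q (h * g) = Q g) ->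
  equidistributed w f (fun g => Q g && (\sum_(h <- hs) mult h g == l)%N)
    (C * ('C(size hs + l - 1, l)%:R * (1 / #|F|%:R ^+ d) ^+ l *
      (1 - 1 / #|F|%:R ^+ d) ^+ size hs)) (b + d * (size hs + l)).
Proof.
move=> eqd; set x : rat := 1 / _.
elim: hs l => [|h hs IHhs] l /= => [_ _ _|/andP[h_hs uniq_hs] irr_hs invQ].
  case: l => [|l] n u mu le_n.
    rewrite bin0 !expr0 !mulr1 -(eqd n u) //; last lia.
    by congr _%:R; apply: eq_count_monic => g _ _; rewrite big_nil eqxx andbT.
  (* For the empty list and a positive total no [g] qualifies, and the binomial coefficient is 0. *)
  rewrite add0n subn1 bin_small // !mul0r mulr0 mul0r; apply/eqP.
  rewrite pnatr_eq0 cards_eq0; apply/eqP/setP => g.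
  by rewrite !inE big_nil !andbF.
have [mh ih] := irr_hs h (mem_head _ _).
have irr_hs' h' : h' \in hs -> monic_of_deg d h' /\ irreducible_poly h'.
  by move=> h'_hs; apply: irr_hs; rewrite in_cons h'_hs orbT.
move=> n u mu le_n.
rewrite (@eq_count_monic _ _ (fun g => ((angle w (u * g) == angle w f) && Q g) &&
    (mult h g + \sum_(h' <- hs) mult h' g == l)%N)); last first.
  by move=> g _ _; rewrite big_cons andbA.
rewrite count_monic_sum natr_sum addSn subn1 /= -sum_bin_diag natr_sum.
rewrite !(mulr_suml, mulr_sumr); apply: eq_bigr => j _.
pose Q' g := Q g && (\sum_(h' <- hs) mult h' g == l - j)%N.
have invQ_hs h' g : h' \in hs -> g \is monic -> Q (h' * g) = Q g.
  by move=> h'_hs; apply: invQ; rewrite in_cons h'_hs orbT.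
have eqd' := IHhs (l - j)%N uniq_hs irr_hs' invQ_hs.
(* [uniq] makes [h] coprime to every member of [hs], so their multiplicities ignore it. *)
have invQ' g : g \is monic -> Q' (h * g) = Q' g.
  move=> mg; rewrite /Q' invQ ?mem_head //; congr (_ && (_ == _)).
  apply: eq_big_seq => h' h'_hs; have [/andP[mh' _] ih'] := irr_hs' h' h'_hs.
  have [mh1 _] := andP mh.
  apply: mult_mul_coprime; rewrite ?monic_neq0 //; first by case: ih'.
  by apply: monic_irreducible_coprimep => //; apply: contraNneq h_hs => <-.
have /(_ n u mu) := equidistributed_mult (j := j) eqd' mh ih invQ'.
have le_j := leq_ord j.
rewrite (@eq_count_monic _ _ (fun g => (angle w (u * g) == angle w f) && Q g &&
    (\sum_(h' <- hs) mult h' g == l - j)%N && (mult h g == j))); last first.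
  by move=> g _ _; rewrite /Q' !andbA.
rewrite -/x => ->; last first.
  (* The costs [d * (size hs + (l - j))] and [d * j.+1] have a sum independent of [j]. *)
  rewrite -(addnA b) -mulnDr; apply: leq_trans le_n.
  by rewrite !leq_add2l leq_mul2l -addnA addnS subnK // addSn addnS leqnn orbT.
by rewrite exprS -[in x ^+ l](subnK le_j) exprD; ring.
Qed.

Lemma IrrP i (h : {poly_(i.+1) F}) : h \in Irr F i ->
  monic_of_deg i (polyn h) /\ irreducible_poly (polyn h).
Proof. by rewrite inE => /andP[-> /irreducibleP]. Qed.

Lemma equidistributed_num_irr_factors (s : seq nat) (l : nat -> nat) w f :
  f \is monic -> uniq s ->
  equidistributed w f (fun g => all (fun i => num_irr_factors i g == l i) s)
    (\prod_(i <- s) ('C(#|Irr F i| + l i - 1, l i)%:R *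
        (1 / #|F|%:R ^+ i) ^+ l i * (1 - 1 / #|F|%:R ^+ i) ^+ #|Irr F i|))
    (\sum_(i <- s) i * (#|Irr F i| + l i))%N.
Proof.
move=> f_monic; elim: s => [_|i s IHs /= /andP[i_s uniq_s]].
  by rewrite !big_nil; exact: equidistributedT.
rewrite !big_cons mulrC [X in equidistributed _ _ _ _ X]addnC.
pose hs := [seq polyn p | p in Irr F i].
have sum_hs g : (\sum_(h <- hs) mult h g)%N = num_irr_factors i g.
  by rewrite big_image.
have size_hs : size hs = #|Irr F i| by rewrite size_image.
rewrite -size_hs.
apply: eq_equidistributed (equidistributed_sum_mult (hs := hs) (IHs uniq_s) _ _ _).
- by move=> g _ /=; rewrite sum_hs andbC.
- by rewrite map_inj_uniq ?enum_uniq //; exact: val_inj.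
- by move=> h /imageP[h' /IrrP irr_h ->].
move=> h g /imageP[h' /IrrP [/andP[mh /eqP sh] ih] ->] mg.
(* Here [k] differs from [i], so irreducibles of degrees [k] and [i] are distinct, hence coprime. *)
apply: eq_in_all => k k_s; congr (_ == _).
apply: eq_bigr => h1 /IrrP[/andP[mh1 /eqP sh1] ih1].
apply: mult_mul_coprime; rewrite ?monic_neq0 //; first by case: ih1.
apply: monic_irreducible_coprimep => //; apply: contraNneq i_s => eq_h.
by move: sh; rewrite -eq_h sh1 => -[<-].
Qed.

End Counting.

Theorem theorem4 (F : finFieldType) (w m : nat) (T : {fset nat})
    (l : nat -> nat) (f : {poly F})
    (T_pos : forall i : nat, i \in T -> (0 < i)%N)
    (f_monic : f \is monic)
    (le_sum : ((\sum_(i <- T) i * (#|Irr F i| + l i))%N%:Z <= m%:Z - w%:Z)) :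
  (Nstar w m T l f)%:R =
    (#|F|%:R : rat) ^+ (m - w) *
      \prod_(i <- T) ('C(#|Irr F i| + l i - 1, l i)%:R *
        (1 / #|F|%:R ^+ i) ^+ l i * (1 - 1 / #|F|%:R ^+ i) ^+ #|Irr F i|).
Proof.
rewrite mulrC.
(* The case [u = 1], [n = m] of equidistribution. *)
rewrite -(equidistributed_num_irr_factors (l := l) f_monic (fset_uniq T) (monic1 F)) //.
  by congr _%:R; apply: eq_card => g; rewrite !inE mul1r.
by rewrite addnC -lez_nat PoszD -lerBrDr.
Qed.
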